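(* Let $\mathcal{T}$ and $\mathcal{T}'$ be elementary abelian regular subgroups of $\mathrm{AGL}(V,+)$ such that $\dim(W(\mathcal{T}))=\dim(W(\mathcal{T}'))=n-2$. Then there exists $g\in\mathrm{GL}(V)$ such that $\mathcal{T}'=\mathcal{T}^g$.
   Context: $n\ge 2$ and $V=(\mathbb{F}_2)^n$. $T=\{\sigma_a\mid a\in V\}$, where $\sigma_a:x\mapsto x+a$, is the translation group, and $\mathrm{AGL}(V,+)=\mathrm{GL}(V)\ltimes T$. For an elementary abelian regular subgroup $\mathcal{T}\le\mathrm{AGL}(V,+)$ (regular in its action on $V$), $W(\mathcal{T})=\{a\in V\mid\sigma_a\in\mathcal{T}\}$, a subspace of $V$. $\mathcal{T}^g=g^{-1}\mathcal{T}g$. *)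

(* Defs.v *)
From HB Require Import structures.
From mathcomp Require Import all_boot all_order all_algebra all_fingroup all_solvable.

Set Implicit Arguments.
Unset Strict Implicit.
Unset Printing Implicit Defensive.

Import GRing.Theory.
Local Open Scope ring_scope.

(* Permutations act on the right, (s * t) x = t (s x), so that
   A :^ g = g^-1 * A * g agrees with the convention for conjugates. *)
Notation V n := 'rV['F_2]_n.

Definition sigma n (a : V n) : {perm V n} := perm (addIr a).

Definition Transl n : {set {perm V n}} := [set sigma a | a : V n].

Definition GL n : {set {perm V n}} :=
  [set g : {perm V n} |
    [forall c : 'F_2, forall x : V n, forall y : V n,
       g (c *: x + y) == c *: g x + g y]].

Definition AGL n : {set {perm V n}} := (Transl n * GL n)%g.

Definition regular n (G : {group {perm V n}}) : Prop :=
  [transitive G, on [set: V n] | 'P]%g /\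
  forall x : V n, ('C_G[x | 'P] = 1)%g.

(* The set of all a with sigma a in G is already a subspace (see mem_W),
   so the span only serves to package it as a {vspace V n}. *)
Definition W n (G : {group {perm V n}}) : {vspace V n} :=
  <<enum [set a : V n | sigma a \in G]>>%VS.

Lemma sigmaE n (a x : V n) : sigma a x = x + a.
Proof. by rewrite permE. Qed.

Lemma sigma0 n : sigma (0 : V n) = 1%g.
Proof. by apply/permP => x; rewrite sigmaE addr0 perm1. Qed.

Lemma sigmaD n (a b : V n) : sigma (a + b) = (sigma a * sigma b)%g.
Proof. by apply/permP => x; rewrite permM !sigmaE addrA. Qed.

Lemma sigmaN n (a : V n) : sigma (- a) = (sigma a)^-1%g.
Proof. by apply/eqP; rewrite eq_sym eq_invg_mul -sigmaD addrN sigma0. Qed.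

Lemma GLP n (g : {perm V n}) : reflect (linear g) (g \in GL n).
Proof.
rewrite inE; apply: (iffP forallP) => [lin_g c x y | lin_g c].
  by have /forallP/(_ x)/forallP/(_ y)/eqP := lin_g c.
by apply/forallP => x; apply/forallP => y; rewrite lin_g.
Qed.

Lemma Transl_group_set n : group_set (Transl n).
Proof.
apply/group_setP; split; first by rewrite -sigma0 imset_f.
by move=> _ _ /imsetP[a _ ->] /imsetP[b _ ->]; rewrite -sigmaD imset_f.
Qed.
Canonical Transl_group n := Group (Transl_group_set n).

Lemma GL_group_set n : group_set (GL n).
Proof.
apply/group_setP; split; first by apply/GLP => c x y; rewrite !perm1.
move=> g h /GLP lin_g /GLP lin_h; apply/GLP => c x y.
by rewrite !permM lin_g lin_h.
Qed.
Canonical GL_group n := Group (GL_group_set n).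

Lemma GL0 n (g : {perm V n}) : g \in GL n -> g 0 = 0.
Proof.
move=> /GLP/(_ (-1) 0 0); rewrite scaler0 addr0 => ->.
by rewrite scaleN1r addNr.
Qed.

Lemma GLD n (g : {perm V n}) : g \in GL n -> {morph g : x y / x + y}.
Proof. by move=> /GLP lin_g x y; rewrite -[x]scale1r lin_g !scale1r. Qed.

Lemma sigmaJ n (g : {perm V n}) (a : V n) :
  g \in GL n -> (sigma a ^ g)%g = sigma (g a).
Proof.
move=> gGL; apply/permP => x.
by rewrite /conjg !permM !sigmaE GLD // permKV.
Qed.

Lemma GL_norm_Transl n : (GL n \subset 'N(Transl n))%g.
Proof.
apply/subsetP => g gGL; rewrite inE; apply/subsetP => _ /imsetP[s sT ->].
by have /imsetP[a _ ->] := sT; rewrite sigmaJ // imset_f.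
Qed.

Lemma AGL_sdprod n : (Transl n ><| GL n)%g = AGL n.
Proof.
rewrite sdprodE ?GL_norm_Transl //; apply/trivgP/subsetP => s.
case/setIP => /imsetP[a _ ->] /GL0.
by rewrite sigmaE add0r => ->; rewrite sigma0 inE.
Qed.

Lemma AGL_group_set n : group_set (AGL n).
Proof. by rewrite /AGL -norm_joinEr ?GL_norm_Transl // groupP. Qed.
Canonical AGL_group n := Group (AGL_group_set n).

Lemma mem_W n (G : {group {perm V n}}) (a : V n) :
  (a \in W G) = (sigma a \in G).
Proof.
apply/idP/idP => [/coord_span-> | aG]; last first.
  by rewrite memv_span // mem_enum inE.
elim/big_ind: _ => [|b c bG cG|i _]; first by rewrite sigma0 group1.
  by rewrite sigmaD groupM.
have := ltn_ord i; rewrite {2}cardE => /(mem_nth 0); rewrite mem_enum inE => biG.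
move: (coord _ i a) => c; rewrite -[c]natr_Zp scaler_nat.
elim: (nat_of_ord c) => [|m IHm]; first by rewrite mulr0n sigma0 group1.
by rewrite mulrS sigmaD groupM.
Qed.

(* Main.v *)
Require Import Defs.
From mathcomp Require Import all_boot all_order all_algebra all_fingroup all_solvable.

Set Implicit Arguments.
Unset Strict Implicit.
Unset Printing Implicit Defensive.

Import GRing.Theory.
Local Open Scope ring_scope.

(** An elementary abelian regular subgroup T of AGL(V) is the same thing as a
    product on V.  Writing each element as s x = x + s 0 + x ** (s 0), linearity
    of x |-> s x + s 0 makes x ** a additive in x, commutativity of T makes it
    symmetric, hence bilinear, and exponent 2 gives x ** x = 0 and
    x ** (x ** y) = 0.  In this dictionary W(T) is the annihilator of the
    product ([mem_W_tmul]).

    When W(T) has codimension 2, pick u and v spanning a complement.  The product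
    only depends on the classes modulo W(T), where it is an alternating form in
    dimension 2, so x ** y is a 2 x 2 determinant in the coordinates along u and
    v times the single vector w = u ** v.  This w is nonzero, as otherwise the
    product would vanish and W(T) would be all of V, and it lies in W(T), by
    x ** (x ** y) = 0.  Completing u, v, w to a basis of V by vectors of W(T)
    thus gives a description of T that only mentions the basis
    ([regular_normal_form]).  The linear map taking the basis adapted to T to the
    one adapted to T' then carries T to T'. *)

(** * Vectors over the field with two elements *)

Lemma addvv n (x : V n) : x + x = 0.
Proof. by apply/rowP => i; rewrite !mxE (addrr_pchar2 (pchar_Fp _)). Qed.

Lemma addvK2 n (x y : V n) : x + y + y = x.
Proof. by rewrite -addrA addvv addr0. Qed.

Lemma F2_cases (c : 'F_2) : c = 0 \/ c = 1.
Proof. by case: c => [[|[|//]] ?]; [left | right]; apply/val_inj. Qed.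

Lemma dimVn n : \dim {:V n} = n.
Proof. by rewrite dimvf dim_matrix; exact: mul1n. Qed.

(** With L x = s x + s 0 the linear part of s, this is L (x + y) = L x + L y; of
    the four copies of s 0 only one survives in characteristic 2. *)
Lemma AGL_affine n (s : {perm V n}) :
  s \in AGL n -> forall x y, s (x + y) = s x + s y + s 0.
Proof.
case/mulsgP => _ h /imsetP[a _ ->] hGL -> x y.
rewrite !permM !sigmaE add0r !(GLD hGL).
by rewrite addrACA -!addrA addvv addr0.
Qed.

(** * The product attached to an elementary abelian regular subgroup *)

Section RegularAbelem.

Variables (n : nat) (T : {group {perm V n}}).
Hypothesis n_gt0 : (0 < n)%N.
Hypothesis T_AGL : T \subset AGL n.
Hypothesis T_abelem : is_abelem T.
Hypothesis T_regular : regular T.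

Lemma regular_commute s t x : s \in T -> t \in T -> s (t x) = t (s x).
Proof.
move=> sT tT; have /centsP cTT := abelem_abelian T_abelem.
by have := cTT t tT s sT => /permP/(_ x); rewrite !permM.
Qed.

Lemma card_regular : #|T| = (2 ^ n)%N.
Proof.
have [trT stT] := T_regular.
have := card_orbit 'P T (0 : V n).
rewrite (atransP trT) ?inE // stT indexg1 => <-.
by rewrite cardsT card_mx card_Fp // mul1n.
Qed.

(** T has order 2 ^ n, which pins the prime of [is_abelem] to 2. *)
Lemma regular_invol s x : s \in T -> s (s x) = x.
Proof.
move=> sT; have := T_abelem.
have pdiv_2n: pdiv (2 ^ n) = 2 by rewrite -(prednK n_gt0) pdiv_pfactor.
rewrite /is_abelem card_regular pdiv_2n => T2.
have [_ /(_ s sT)] := abelemP (isT : prime 2) T2.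
by rewrite expgS expg1 => /permP/(_ x); rewrite permM perm1.
Qed.

Definition elt_to (a : V n) : {perm V n} :=
  odflt 1%g [pick s in T | s 0 == a].

Lemma elt_toP a : elt_to a \in T /\ elt_to a 0 = a.
Proof.
rewrite /elt_to; case: pickP => [s /andP[sT /eqP] // | no_s].
have [trT _] := T_regular.
have [s sT Da] := atransP2 trT (in_setT 0) (in_setT a).
by have := no_s s; rewrite sT Da /= eqxx.
Qed.

(** The defect of x |-> elt_to a x from being the translation by a. *)
Definition tmul (x a : V n) : V n := elt_to a x + x + a.
Local Notation "x ** y" := (tmul x y) (at level 40, left associativity).

Lemma elt_to_tmul a x : elt_to a x = x + a + x ** a.
Proof. by rewrite /tmul -[elt_to a x + x + a]addrA [RHS]addrC addvK2. Qed.

(** In an abelian transitive group an element is determined by the image of 0: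
    x is the image of 0 under some t, and s (t 0) = t (s 0). *)
Lemma regular_eltE s : s \in T -> s = elt_to (s 0).
Proof.
move=> sT; apply/permP => x.
have [tT <-] := elt_toP x; have [aT Da] := elt_toP (s 0).
by rewrite regular_commute // -{1}Da regular_commute.
Qed.

Lemma regular_tmulE s x : s \in T -> s x = x + s 0 + x ** s 0.
Proof. by move=> sT; rewrite {1}(regular_eltE sT) elt_to_tmul. Qed.

(** Evaluating at 0 the commutation of the elements sending 0 to x and to a. *)
Lemma tmulC x a : x ** a = a ** x.
Proof.
have [xT Dx] := elt_toP x; have [aT Da] := elt_toP a.
rewrite /tmul -{1}Dx regular_commute // Da.
by rewrite -!addrA [x + a]addrC.
Qed.

Lemma tmulDl x y a : (x + y) ** a = x ** a + y ** a.
Proof.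
have [aT Da] := elt_toP a.
rewrite /tmul (AGL_affine (subsetP T_AGL _ aT)) Da.
rewrite addrACA [elt_to a x + x + a + _]addrACA.
rewrite [elt_to a x + x + _]addrACA -!addrA; congr (_ + (_ + _)).
by rewrite [a + _]addrC -!addrA.
Qed.

Lemma tmul0l a : 0 ** a = 0.
Proof. by rewrite /tmul; have [_ ->] := elt_toP a; rewrite addr0 addvv. Qed.

Lemma tmulZl c x a : (c *: x) ** a = c *: (x ** a).
Proof. by case: (F2_cases c) => ->; rewrite ?scale0r ?scale1r ?tmul0l. Qed.

Lemma tmulDr a x y : a ** (x + y) = a ** x + a ** y.
Proof. by rewrite tmulC tmulDl !(tmulC a). Qed.

Lemma tmulZr c a x : a ** (c *: x) = c *: (a ** x).
Proof. by rewrite tmulC tmulZl tmulC. Qed.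

(** The element sending 0 to x is an involution, so it sends x back to 0. *)
Lemma tmulxx x : x ** x = 0.
Proof.
have [xT Dx] := elt_toP x.
by rewrite /tmul -{2}Dx regular_invol // add0r addvv.
Qed.

(** This is the vector by which the square of the element sending 0 to x
    displaces y. *)
Lemma tmul_nil x y : x ** (x ** y) = 0.
Proof.
have [xT _] := elt_toP x.
have := regular_invol y xT.
(* The count is bounded because y ** x itself unfolds to a sum. *)
rewrite (elt_to_tmul x (elt_to x y)) (elt_to_tmul x y) 2!tmulDl tmulxx addr0
  (tmulC x (x ** y)) (tmulC x y).
rewrite [y + x + _ + x]addrAC addvK2 addrA addvK2.
by move/(canRL (addKr _)); rewrite addNr.
Qed.

Lemma mem_W_tmul a : reflect (forall x, x ** a = 0) (a \in W T).
Proof.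
rewrite mem_W; apply: (iffP idP) => [aT x | a0].
  have := regular_tmulE x aT; rewrite !sigmaE add0r.
  by move/esym/(canRL (addKr _)); rewrite addNr.
have [aT _] := elt_toP a; congr (_ \in T): aT; apply/permP => x.
by rewrite elt_to_tmul a0 addr0 sigmaE.
Qed.

(** The annihilator contributes nothing, and an alternating form on the span of
    two vectors is a determinant (the sign being irrelevant in characteristic
    2). *)
Lemma tmul_span2 u v a b r a' b' r' : r \in W T -> r' \in W T ->
  (a *: u + b *: v + r) ** (a' *: u + b' *: v + r')
    = (a * b' + b * a') *: (u ** v).
Proof.
move=> /mem_W_tmul rW /mem_W_tmul r'W.
rewrite tmulDr r'W addr0 [LHS]tmulC tmulDr rW addr0 [LHS]tmulC.
rewrite tmulDl !tmulDr !tmulZl !tmulZr !tmulxx !scaler0 add0r addr0.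
by rewrite [v ** u]tmulC !scalerA -scalerDl.
Qed.

Hypothesis n_ge2 : (2 <= n)%N.
Hypothesis dimW : \dim (W T) = (n - 2)%N.

Lemma complement_W_pair :
  exists u v, (<[u]> + (<[v]> + W T))%VS = fullv.
Proof.
have size2: size (vbasis (W T)^C) = 2.
  by rewrite size_tuple dimv_compl dimVn dimW subKn.
have := addv_complf (W T).
rewrite -(span_basis (vbasisP (W T)^C)).
case: (tval _) size2 => [|u [|v []]] //= _ <-.
by exists u, v; rewrite span_cons span_seq1 addvA addvC.
Qed.

Lemma complement_W_decomp u v x : (<[u]> + (<[v]> + W T))%VS = fullv ->
  exists a b r, r \in W T /\ x = a *: u + b *: v + r.
Proof.
move=> Duv; have: x \in fullv by apply: memvf.
rewrite -Duv => /memv_addP[_ /vlineP[a ->] [y /memv_addP]].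
case=> _ /vlineP[b ->] [r rW ->] ->.
by exists a, b, r; rewrite addrA.
Qed.

(** Otherwise the product would be zero, making T the whole translation
    group. *)
Lemma tmul_complement_neq0 u v :
  (<[u]> + (<[v]> + W T))%VS = fullv -> u ** v != 0.
Proof.
move=> Duv; apply/eqP => uv0.
have WT: (fullv <= W T)%VS.
  apply/subvP => y _; apply/mem_W_tmul => x.
  have [a [b [r [rW ->]]]] := complement_W_decomp x Duv.
  have [a' [b' [r' [r'W ->]]]] := complement_W_decomp y Duv.
  by rewrite tmul_span2 // uv0 scaler0.
have := dimvS WT; rewrite dimVn dimW leqNgt ltn_subrL n_gt0.
by [].
Qed.

(** u and v kill u ** v by nilpotency, and so does W(T) by definition. *)
Lemma tmul_complement_W u v :
  (<[u]> + (<[v]> + W T))%VS = fullv -> u ** v \in W T.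
Proof.
move=> Duv; apply/mem_W_tmul => x.
have [a [b [r [rW ->]]]] := complement_W_decomp x Duv.
rewrite !tmulDl !tmulZl tmul_nil [u ** v]tmulC tmul_nil !scaler0 !add0r.
by rewrite tmulC (mem_W_tmul _ rW).
Qed.

End RegularAbelem.

(** * Normal form and conjugation *)

Local Notation i0 := ord0.
Local Notation i1 := (lift ord0 ord0).

Definition coord_det n m (X : m.+3.-tuple (V n)) (x y : V n) : 'F_2 :=
  coord X i0 x * coord X i1 y + coord X i1 x * coord X i0 y.

(** The right-hand side depends on T only through the basis X.  The basis used is
    u, v, u ** v followed by a basis of a complement of <u ** v> in W(T).
    The length (n - 3) + 3 is n because u ** v is a nonzero vector of W(T), which
    rules out n = 2. *)
Lemma regular_normal_form n (T : {group {perm V n}}) :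
    (2 <= n)%N -> T \subset AGL n -> is_abelem T -> regular T ->
    \dim (W T) = (n - 2)%N ->
  exists2 X : (n - 3).+3.-tuple (V n), basis_of fullv X &
    forall s x, s \in T -> s x = x + s 0 + coord_det X x (s 0) *: X`_2.
Proof.
move=> n2 T_AGL T_abelem T_reg dimW; have n0 : (0 < n)%N by apply: ltnW.
have [u [v Duv]] := complement_W_pair n2 dimW.
set w := tmul T u v.
have w0 : w != 0 by apply: tmul_complement_neq0.
have wW : w \in W T by apply: tmul_complement_W.
pose D := (W T :\: <[w]>)%VS.
have wD : (<[w]> + D)%VS = W T.
  by rewrite addvC addv_diff; apply/addv_idPl; rewrite -memvE.
have dimD : \dim D = (n - 3)%N.
  have := dimv_cap_compl (W T) <[w]>.
  have /capv_idPr-> : (<[w]> <= W T)%VS by rewrite -memvE.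
  rewrite dim_vline w0 dimW -/D (subnS n 2) => <-.
  by [].
have sizeX : size [:: u, v, w & vbasis D] == (n - 3).+3.
  by rewrite /= size_tuple dimD.
pose X := Tuple sizeX.
have n3 : (3 <= n)%N.
  have : (0 < \dim (W T))%N.
    rewrite lt0n dimv_eq0; apply/eqP => W0.
    by move: wW; rewrite W0 memv0 (negPf w0).
  by rewrite dimW subn_gt0.
have basX : basis_of fullv X.
  have -> := basisEdim X fullv; rewrite dimVn.
  have -> : size X = n by rewrite size_tuple -addn3 subnK.
  rewrite leqnn andbT.
  by rewrite /= !span_cons (span_basis (vbasisP D)) wD Duv.
have decX x : exists2 r, r \in W T & x = coord X i0 x *: u + coord X i1 x *: v + r.
  have := coord_basis basX (memvf x); rewrite 2!big_ord_recl /= addrA => Dx.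
  eexists; last exact: Dx.
  apply: memv_suml => i _; apply: memvZ.
  have: nth 0 (w :: vbasis D) i \in w :: vbasis D.
    by rewrite mem_nth //= size_tuple dimD.
  rewrite inE => /predU1P[-> // | /vbasis_mem iD].
  by rewrite -wD; apply: subvP iD; rewrite addvSr.
exists X => // s x sT; rewrite (regular_tmulE T_abelem T_reg) //; congr (_ + _).
have [r rW Dx] := decX x; have [r' r'W Ds] := decX (s 0).
by rewrite {1}Dx {1}Ds tmul_span2.
Qed.

Lemma basis_change n m (X X' : m.-tuple (V n)) :
    basis_of fullv X -> basis_of fullv X' ->
  exists2 g : {perm V n}, g \in GL n &
    (forall i x, coord X' i (g x) = coord X i x)
    /\ (forall i : 'I_m, g X`_i = X'`_i).
Proof.
move=> basX basX'.
have freeX := basis_free basX; have freeX' := basis_free basX'.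
pose f x := \sum_i coord X i x *: X'`_i.
have coord_f i x : coord X' i (f x) = coord X i x by rewrite coord_sum_free.
have inj_f : injective f.
  move=> x y eq_f; rewrite (coord_basis basX (memvf x)).
  rewrite (coord_basis basX (memvf y)).
  by apply: eq_bigr => i _; rewrite -!coord_f eq_f.
exists (perm inj_f); last split=> [i x | i]; rewrite ?permE //.
  apply/GLP => c x y; rewrite !permE /f scaler_sumr -big_split /=.
  by apply: eq_bigr => i _; rewrite linearP scalerDl scalerA.
rewrite /f (bigD1 i) //= coord_free // eqxx scale1r big1 ?addr0 // => j ne_ji.
by rewrite coord_free // eq_sym (negPf ne_ji) scale0r.
Qed.

Theorem proposition4p10 (n : nat) (hn : (2 <= n)%N)
  (T T' : {group {perm V n}})
  (T_AGL : T \subset AGL n) (T'_AGL : T' \subset AGL n)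
  (T_abelem : is_abelem T) (T'_abelem : is_abelem T')
  (T_regular : regular T) (T'_regular : regular T')
  (dimW : \dim (W T) = (n - 2)%N) (dimW' : \dim (W T') = (n - 2)%N) :
  exists2 g : {perm V n}, g \in GL n & T' :=: (T :^ g)%g.
Proof.
have [X basX nfX] := regular_normal_form hn T_AGL T_abelem T_regular dimW.
have [X' basX' nfX'] :=
  regular_normal_form hn T'_AGL T'_abelem T'_regular dimW'.
have [g gGL [coord_g gX]] := basis_change basX basX'.
exists g => //; apply/esym/eqP.
rewrite eqEcard cardJg !card_regular // leqnn andbT.
apply/subsetP => _ /imsetP[s sT ->].
(* By equality of orders an inclusion is enough, and the conjugate of s can only
   be the element of T' sending 0 = g 0 to g (s 0). *)
have [tT' Dt] := elt_toP T'_regular (g (s 0)).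
congr (_ \in T'): (tT'); apply/permP => x; rewrite -(permKV g x).
move: (g^-1%g x) => y; rewrite conjgE !permM permK.
rewrite (nfX s y sT) (nfX' _ _ tT') Dt !(GLD gGL); congr (_ + _).
rewrite /coord_det !coord_g -(gX (lift ord0 (lift ord0 ord0))).
have := elimT (GLP g) gGL (coord_det X y (s 0)) X`_2 0.
by rewrite (GL0 gGL) !addr0.
Qed.
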